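(* For every $\mu\in\mathbb F$, $(V,\phi_\mu)$ is a reducible module of the Lie algebra $\mathrm{ad}(A_\omega^\delta)$, and: 1) for all $\alpha\in\mathbb F\setminus\mathbb Z$, $U(\alpha)=\sum_{m\in\mathbb Z}\mathbb F v_{\alpha+m}$ is an irreducible submodule; 2) $U(0)=\sum_{m\in\mathbb Z}\mathbb F v_m$ is an indecomposable submodule containing an irreducible submodule $\bar U=\sum_{m\in\mathbb Z,\ m\neq0}\mathbb F v_m$; 3) $(V,\phi_\mu)$ is not an induced module.
   Context: $\mathbb F$ is a field of characteristic zero (so $\mathbb Z\subset\mathbb F$); all vector spaces and algebras are over $\mathbb F$. A 3-Lie algebra is a vector space $B$ with a linear map $[\,,\,,\,]:B\wedge B\wedge B\to B$ satisfying $[x_1,x_2,[x_3,x_4,x_5]]=[[x_1,x_2,x_3],x_4,x_5]+[x_3,[x_1,x_2,x_4],x_5]+[x_3,x_4,[x_1,x_2,x_5]]$. For $x,y\in B$, $\mathrm{ad}(x,y)(z)=[x,y,z]$; the inner derivation algebra $\mathrm{ad}(B)$ is the Lie algebra (under the commutator) of all linear combinations of the maps $\mathrm{ad}(x,y)$. A module of a 3-Lie algebra $B$ is a pair $(W,\rho)$, with $W$ a vector space and $\rho:B\wedge B\to gl(W)$ linear, such that for all $x_i\in B$: $[\rho(x_1,x_2),\rho(x_3,x_4)]=\rho([x_1,x_2,x_3],x_4)+\rho(x_3,[x_1,x_2,x_4])$ and $\rho([x_1,x_2,x_3],x_4)=\rho(x_1,x_2)\rho(x_3,x_4)+\rho(x_2,x_3)\rho(x_1,x_4)+\rho(x_3,x_1)\rho(x_2,x_4)$.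 Induced modules: for a $B$-module $(W,\rho)$, let $L_\rho(W)$ be the linear span of $\{\rho(x,y)\mid x,y\in B\}$, a Lie subalgebra of $gl(W)$. If the center $Z(L_\rho(W))$ is $0$, there is a well-defined linear map $\bar\rho:\mathrm{ad}(B)\to gl(W)$ with $\bar\rho(\mathrm{ad}(x,y))=\rho(x,y)$ for all $x,y\in B$, and $(W,\bar\rho)$ is an $\mathrm{ad}(B)$-module, called the induced module associated with the $B$-module $(W,\rho)$. An $\mathrm{ad}(B)$-module is an induced module if it equals $(W,\bar\rho)$ for some such $B$-module $(W,\rho)$. $A_\omega^\delta$ is the (simple) 3-Lie algebra with basis $\{L_r,M_r\mid r\in\mathbb Z\}$ and (skew-symmetric) bracket determined by $[L_r,L_s,M_t]=(s-r)L_{r+s-t}$, $[L_r,M_s,M_t]=(t-s)M_{s+t-r}$ for $r,s,t\in\mathbb Z$, all other brackets of basis elements (i.e. $[L_r,L_s,L_t]$ and $[M_r,M_s,M_t]$) being zero. It is known that $\mathrm{ad}(A_\omega^\delta)$ has a basis $\{p_r,q_r,x_r,z_r\mid r\in\mathbb Z\}$, where for $r\neq0$: $p_r=\frac12(\mathrm{ad}(L_0,M_{-r})+\mathrm{ad}(L_r,M_0))$, $q_r=\frac1r(\mathrm{ad}(L_0,M_{-r})-\mathrm{ad}(L_r,M_0))$, $x_r=\frac1r\mathrm{ad}(L_r,L_0)$, $z_r=\frac1{-r}\mathrm{ad}(M_{-r},M_0)$; and $p_0=\mathrm{ad}(L_0,M_0)$, $q_0=\mathrm{ad}(L_0,M_0)-\mathrm{ad}(L_1,M_1)$,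 $x_0=\frac12\mathrm{ad}(L_1,L_{-1})$, $z_0=\frac12\mathrm{ad}(M_1,M_{-1})$. The Lie brackets are: $[p_r,p_s]=(r-s)p_{r+s}$, $[p_r,q_s]=-sq_{r+s}$, $[p_r,x_s]=-sx_{r+s}$, $[p_r,z_s]=-sz_{r+s}$, $[q_r,x_s]=-2x_{r+s}$, $[q_r,z_s]=2z_{r+s}$, $[z_r,x_s]=q_{r+s}$, the others being zero. $V=\sum_{\alpha\in\mathbb F}\mathbb F v_\alpha$ is the vector space with basis $\{v_\alpha\mid\alpha\in\mathbb F\}$. For $\mu\in\mathbb F$, the linear map $\phi_\mu:\mathrm{ad}(A_\omega^\delta)\to gl(V)$ is defined by: $\phi_\mu(p_r)v_\alpha=(\alpha-r)v_{\alpha-r}$ for $r\in\mathbb Z\setminus\{0\}$, $\alpha\in\mathbb F\setminus\{0\}$; $\phi_\mu(p_r)v_0=r(\mu-r)v_{-r}$ for $r\in\mathbb Z\setminus\{0\}$; $\phi_\mu(p_0)v_\alpha=\alpha v_\alpha$ for $\alpha\in\mathbb F$; $\phi_\mu(q_r)v_\alpha=\phi_\mu(x_r)v_\alpha=\phi_\mu(z_r)v_\alpha=0$ for $r\in\mathbb Z$, $\alpha\in\mathbb F$. A module is irreducible if it has no submodules other than $0$ and itself, and reducible otherwise. *)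

(* Defs.v *)
From HB Require Import structures.
From mathcomp Require Import all_boot all_algebra.
From mathcomp Require Import finmap monalg.
From mathcomp Require Import boolp classical_sets functions.
From mathcomp Require Import ring.

Set Implicit Arguments.
Unset Strict Implicit.
Unset Printing Implicit Defensive.

Import GRing.Theory.
Local Open Scope classical_set_scope.
Local Open Scope ring_scope.

Section LinearAlgebra.
Variables (F : fieldType) (V W : lmodType F).

Definition subspace (U : set V) : Prop :=
  U 0 /\ forall (a : F) (u v : V), U u -> U v -> U (a *: u + v).

Definition lspan (S : set V) : set V :=
  [set v | exists (n : nat) (a : 'I_n -> F) (s : 'I_n -> V),
     (forall i, S (s i)) /\ v = \sum_(i < n) a i *: s i].

Lemma lspan_gen (S : set V) v : S v -> lspan S v.
Proof.
move=> Sv; exists 1, (fun=> 1), (fun=> v); split=> //.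
by rewrite big_ord1 scale1r.
Qed.

Lemma lspan_subspace (S : set V) : subspace (lspan S).
Proof.
split=> [|a u v [n1 [a1 [s1 [S1 ->]]]] [n2 [a2 [s2 [S2 ->]]]]].
  exists 0, (fun=> 0), (fun=> 0); split; first by case.
  by rewrite big_ord0.
exists (n1 + n2)%N.
exists (fun i : 'I_(n1 + n2) => match fintype.split i with inl j => a * a1 j | inr j => a2 j end).
exists (fun i : 'I_(n1 + n2) => match fintype.split i with inl j => s1 j | inr j => s2 j end).
split=> [i|]; first by case: (fintype.split i).
rewrite big_split_ord scaler_sumr /=; congr (_ + _); apply: eq_bigr => i _.
  by rewrite -[lshift _ _]/(unsplit (inl i)) unsplitK scalerA.
by rewrite -[rshift _ _]/(unsplit (inr i)) unsplitK.
Qed.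

Lemma lspan_ind (S : set V) (U : set V) :
  subspace U -> S `<=` U -> lspan S `<=` U.
Proof.
move=> [U0 UD] SU v [n [a [s [Ss ->]]]].
elim/big_ind: _ => // [u w Uu Uw|i _].
  by rewrite -[u]scale1r; apply: UD.
by rewrite -[_ *: _]addr0; apply: UD => //; apply/SU/Ss.
Qed.

End LinearAlgebra.

Section LinearMaps.
Variable F : fieldType.

Fact lincomp (U V W : lmodType F) (f : V -> W) (g : U -> V) :
  linear f -> linear g -> linear (fun x => f (g x)).
Proof. by move=> lf lg a u v; rewrite lg lf. Qed.

Fact linadd (V W : lmodType F) (f g : V -> W) :
  linear f -> linear g -> linear (fun x => f x + g x).
Proof. by move=> lf lg a u v; rewrite lg lf scalerDr addrACA. Qed.

Fact linB (V W : lmodType F) (f : V -> W) :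
  linear f -> forall u v, f (u - v) = f u - f v.
Proof. by move=> lf u v; rewrite addrC -scaleN1r lf scaleN1r addrC. Qed.

Fact lin0 (V W : lmodType F) (f : V -> W) : linear f -> f 0 = 0.
Proof.
move=> lf; have := lf (-1) 0 0.
by rewrite scaler0 addr0 scaleN1r addNr.
Qed.

Fact linZ (V W : lmodType F) (f : V -> W) :
  linear f -> forall a u, f (a *: u) = a *: f u.
Proof. by move=> lf a u; rewrite -[a *: u]addr0 lf lin0 // addr0. Qed.

End LinearMaps.

(* [{malg F[K]}] is the vector space over [F] with basis [bvec F k], [k : K];
   [mlin f] is its linear map sending each [bvec F k] to [f k]. *)
HB.lock Definition bvec (F : fieldType) (K : choiceType) (k : K) :
  {malg F[K]} := << k >>.

Section LinearExtension.
Variables (F : fieldType) (K : choiceType) (W : lmodType F).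

Definition mlin (f : K -> W) (x : {malg F[K]}) : W :=
  \sum_(k <- msupp x) x@_k *: f k.

Lemma mlinEw (f : K -> W) x (d : {fset K}) : (msupp x `<=` d)%fset ->
  mlin f x = \sum_(k <- d) x@_k *: f k.
Proof.
move=> le; rewrite /mlin (big_fset_incl _ le) //= => k _ /mcoeff_outdom ->.
by rewrite scale0r.
Qed.

Lemma mlin_linear (f : K -> W) : linear (mlin f).
Proof.
move=> a x y; pose d := (msupp x `|` msupp y)%fset.
have ld: (msupp (a *: x + y) `<=` d)%fset.
  apply: (fsubset_trans (msuppD_le _ _)); apply: fsetUSS => //.
  exact: msuppZ_le.
rewrite (mlinEw _ ld) (@mlinEw _ x d) ?fsubsetUl //.
rewrite (@mlinEw _ y d) ?fsubsetUr // scaler_sumr -big_split /=.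
by apply: eq_bigr => k _; rewrite mcoeffD mcoeffZ scalerDl scalerA.
Qed.

HB.instance Definition _ (f : K -> W) :=
  GRing.isLinear.Build F {malg F[K]} W *:%R (mlin f) (mlin_linear f).

Lemma mlinU (f : K -> W) k : mlin f (bvec F k) = f k.
Proof. by rewrite bvec.unlock /mlin msuppU oner_eq0 big_seq_fset1 mcoeffUU scale1r. Qed.

Lemma malg_expand (x : {malg F[K]}) : x = \sum_(k <- msupp x) x@_k *: bvec F k.
Proof.
rewrite {1}[x]monalgE; apply: eq_bigr => k _.
by apply/malgP => j; rewrite bvec.unlock mcoeffZ !mcoeffU mulrnAr mulr1.
Qed.

Lemma malg_linear_ext (f g : {malg F[K]} -> W) : linear f -> linear g ->
  (forall k, f (bvec F k) = g (bvec F k)) -> f =1 g.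
Proof.
move=> lf lg fg x.
pose cf := GRing.isLinear.Build _ _ _ _ _ lf.
pose cg := GRing.isLinear.Build _ _ _ _ _ lg.
pose F1 : {linear {malg F[K]} -> W} := HB.pack f cf.
pose G1 : {linear {malg F[K]} -> W} := HB.pack g cg.
suff: F1 x = G1 x by [].
rewrite [x]malg_expand !linear_sum; apply: eq_bigr => k _.
by rewrite !linearZ; congr (_ *: _); apply: fg.
Qed.

End LinearExtension.

HB.mixin Record Lmodule_isThreeLie (F : fieldType) (B : Type)
    of GRing.Lmodule F B := {
  tbr : B -> B -> B -> B;
  tbr_linear1 : forall y z, linear (fun x => tbr x y z);
  tbr_linear2 : forall x z, linear (fun y => tbr x y z);
  tbr_linear3 : forall x y, linear (fun z => tbr x y z);
  tbr_alt12 : forall x z, tbr x x z = 0;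
  tbr_alt23 : forall x y, tbr x y y = 0;
  tbr_fundamental : forall x1 x2 x3 x4 x5,
    tbr x1 x2 (tbr x3 x4 x5) =
      tbr (tbr x1 x2 x3) x4 x5 + tbr x3 (tbr x1 x2 x4) x5
      + tbr x3 x4 (tbr x1 x2 x5)
}.

HB.structure Definition ThreeLie (F : fieldType) :=
  {B of GRing.Lmodule F B & Lmodule_isThreeLie F B}.

Notation threeLieType := ThreeLie.type.
Notation "[3 x , y , z ]" := (tbr x y z)
  (at level 0, x, y, z at level 200, format "[3  x ,  y ,  z ]").

HB.mixin Record Lmodule_isLie (F : fieldType) (L : Type)
    of GRing.Lmodule F L := {
  lbr : L -> L -> L;
  lbr_linear1 : forall y, linear (fun x => lbr x y);
  lbr_linear2 : forall x, linear (fun y => lbr x y);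
  lbr_alt : forall x, lbr x x = 0;
  lbr_jacobi : forall x y z,
    lbr x (lbr y z) + lbr y (lbr z x) + lbr z (lbr x y) = 0
}.

HB.structure Definition LieAlgebra (F : fieldType) :=
  {L of GRing.Lmodule F L & Lmodule_isLie F L}.

Notation lieAlgType := LieAlgebra.type.

Lemma jacobi_sum (V : zmodType) (a b c d e i : V) :
  (a - b - (c - d)) + (c - e - (i - b)) + (i - d - (a - e)) = 0.
Proof.
have eq4 (x y z t : V) : x - y - (z - t) = (x + t) - (y + z).
  by rewrite opprB addrACA -opprD.
rewrite !eq4 (addrC c b) subrKA (addrC i e) subrKA.
by rewrite (addrC d a) subrr.
Qed.

Section Commutator.
Variables (F : fieldType) (W : lmodType F).

Definition comm (f g : W -> W) : W -> W := fun w => f (g w) - g (f w).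

End Commutator.

Section InnerDerivations.
Variables (F : fieldType) (B : threeLieType F).

Definition ad (x y : B) : B -> B := fun z => [3 x, y, z].

Definition ad_set : set (B -> B) :=
  lspan [set f | exists x y : B, f = ad x y].

Definition ad_pred : {pred (B -> B)} := fun f => `[< ad_set f >].

Fact ad_submod_closed : submod_closed ad_pred.
Proof.
have [s0 sD] : subspace ad_set := lspan_subspace _.
split=> [|a f g]; first exact/asboolP.
by move=> /asboolP sf /asboolP sg; apply/asboolP/sD.
Qed.

HB.instance Definition _ :=
  GRing.isSubmodClosed.Build F (B -> B) ad_pred ad_submod_closed.

Record adAlg := AdAlg { adval :> B -> B; advalP : adval \in ad_pred }.

HB.instance Definition _ := [isSub for adval].
HB.instance Definition _ := [Choice of adAlg by <:].
HB.instance Definition _ := [SubChoice_isSubLmodule of adAlg by <:].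

Lemma adP (x y : B) : ad x y \in ad_pred.
Proof. by apply/asboolP/lspan_gen; exists x, y. Qed.

Definition adm (x y : B) : adAlg := AdAlg (adP x y).

Lemma ad_linear (f : B -> B) : ad_set f -> linear f.
Proof.
apply: lspan_ind; last by move=> _ [x [y ->]]; apply: tbr_linear3.
split=> [a u v|b g h lg lh a u v]; first by rewrite /= scaler0 addr0.
rewrite !fctE lg lh.
by rewrite !scalerDr !scalerA [b * a]mulrC !addrA; congr (_ + _); rewrite addrAC.
Qed.

Lemma comm_ad x y z w :
  comm (ad x y) (ad z w) = ad [3 x, y, z] w + ad z [3 x, y, w].
Proof.
apply/funext => v; rewrite /comm !fctE /= /ad tbr_fundamental.
by rewrite addrK.
Qed.

Lemma comm_linear1 (h : B -> B) : linear h -> linear (fun f => comm f h).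
Proof.
move=> lh a f g; apply/funext => v; rewrite /comm !fctE /= lh.
by rewrite scalerBr opprD addrACA.
Qed.

Lemma comm_linear2 (h : B -> B) : linear h -> linear (comm h).
Proof.
move=> lh a f g; apply/funext => v; rewrite /comm !fctE /= lh.
by rewrite scalerBr opprD addrACA.
Qed.

Lemma comm_ad_set (f g : B -> B) : ad_set f -> ad_set g -> ad_set (comm f g).
Proof.
have [s0 sD] : subspace ad_set := lspan_subspace _.
move=> sf sg.
have lg := ad_linear sg.
move: f sf; apply: lspan_ind.
  split=> [|a u v su sv].
    suff -> : comm 0 g = 0 by [].
    by apply/funext => v; rewrite /comm /= (lin0 lg) subrr.
  by rewrite /= comm_linear1 //; apply: sD.
move=> _ [x [y ->]] /=.
have lxy : linear (ad x y) by apply: tbr_linear3.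
move: g sg {lg}; apply: lspan_ind.
  split=> [|a u v su sv] /=; last by rewrite comm_linear2 //; apply: sD.
  suff -> : comm (ad x y) 0 = 0 by [].
  by apply/funext => v; rewrite /comm /= (lin0 lxy) subrr.
move=> _ [z [w ->]] /=; rewrite comm_ad -[ad _ w]scale1r.
by apply: sD; apply: lspan_gen; do 2 eexists.
Qed.

Lemma ad_commP (f g : adAlg) : comm f g \in ad_pred.
Proof.
by apply/asboolP/comm_ad_set; apply/asboolP/advalP.
Qed.

Definition ad_lbr (f g : adAlg) : adAlg := AdAlg (ad_commP f g).

Fact ad_lbr_linear1 g : linear (fun f => ad_lbr f g).
Proof.
move=> a f h; apply/val_inj => /=; apply: comm_linear1.
by apply: ad_linear; apply/asboolP/(advalP g).
Qed.

Fact ad_lbr_linear2 f : linear (ad_lbr f).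
Proof.
move=> a g h; apply/val_inj => /=; apply: comm_linear2.
by apply: ad_linear; apply/asboolP/(advalP f).
Qed.

Fact ad_lbr_alt f : ad_lbr f f = 0.
Proof. by apply/val_inj/funext => v; rewrite /= /comm subrr. Qed.

Fact ad_lbr_jacobi f g h :
  ad_lbr f (ad_lbr g h) + ad_lbr g (ad_lbr h f) + ad_lbr h (ad_lbr f g) = 0.
Proof.
apply/val_inj/funext => v /=; rewrite /comm !fctE /=.
have lin (k : adAlg) : linear k by apply/ad_linear/asboolP/(advalP k).
rewrite !(linB (lin _)).
exact: jacobi_sum.
Qed.

HB.instance Definition _ := Lmodule_isLie.Build F adAlg
  ad_lbr_linear1 ad_lbr_linear2 ad_lbr_alt ad_lbr_jacobi.

End InnerDerivations.

Section Aomega.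
Variable F : fieldType.

Definition Aod : Type := {malg F[(int + int)%type]}.
HB.instance Definition _ := GRing.Lmodule.on Aod.

Definition bL (r : int) : Aod := bvec F (inl r : int + int).
Definition bM (r : int) : Aod := bvec F (inr r : int + int).

Definition Aod_basis_br (i j k : int + int) : Aod :=
  match i, j, k with
  | inl r, inl s, inr t => (s - r)%:~R *: bL (r + s - t)
  | inl r, inr t, inl s => (r - s)%:~R *: bL (r + s - t)
  | inr t, inl r, inl s => (s - r)%:~R *: bL (r + s - t)
  | inl r, inr s, inr t => (t - s)%:~R *: bM (s + t - r)
  | inr s, inl r, inr t => (s - t)%:~R *: bM (s + t - r)
  | inr s, inr t, inl r => (t - s)%:~R *: bM (s + t - r)
  | inl _, inl _, inl _ | inr _, inr _, inr _ => 0
  end.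

Definition Aod_br (x y z : Aod) : Aod :=
  mlin (fun i => mlin (fun j => mlin (fun k => Aod_basis_br i j k) z) y) x.

Lemma Aod_brU i j k : Aod_br (bvec F i) (bvec F j) (bvec F k) = Aod_basis_br i j k.
Proof. by rewrite /Aod_br !mlinU. Qed.

Fact Aod_br_linear1 y z : linear (fun x => Aod_br x y z).
Proof. exact: mlin_linear. Qed.

Fact mlin_linear_fun (K : choiceType) (V W : lmodType F) (f : K -> V -> W) x :
  (forall i, linear (f i)) -> linear (fun y => mlin (fun i => f i y) x).
Proof.
move=> lf a u v; rewrite /mlin scaler_sumr -big_split /=.
apply: eq_bigr => k _.
by rewrite lf scalerDr !scalerA mulrC.
Qed.

Fact Aod_br_linear2 x z : linear (fun y => Aod_br x y z).
Proof. by apply: mlin_linear_fun => i; apply: mlin_linear. Qed.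

Fact Aod_br_linear3 x y : linear (fun z => Aod_br x y z).
Proof.
by apply: mlin_linear_fun => i; apply: mlin_linear_fun => j; apply: mlin_linear.
Qed.

Fact scal_eq (V : lmodType F) (g : int -> V) (c c1 : F) n n1 :
  c = c1 -> n = n1 -> c *: g n = c1 *: g n1.
Proof. by move=> -> ->. Qed.

Fact scal_eq2 (V : lmodType F) (g : int -> V) (c c1 c2 : F) n n1 n2 :
  c = c1 + c2 -> n = n1 -> n = n2 -> c *: g n = c1 *: g n1 + c2 *: g n2.
Proof. by move=> -> <- <-; rewrite scalerDl. Qed.

Fact scal_eq20 (V : lmodType F) (g : int -> V) (c1 c2 : F) n1 n2 :
  c1 = - c2 -> n1 = n2 -> 0 = c1 *: g n1 + c2 *: g n2.
Proof. by move=> -> <-; rewrite -scalerDl addNr scale0r. Qed.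

Fact scal_eq3 (V : lmodType F) (g : int -> V) (c c1 c2 c3 : F) n n1 n2 n3 :
  c = c1 + c2 + c3 -> n = n1 -> n = n2 -> n = n3 ->
  c *: g n = c1 *: g n1 + c2 *: g n2 + c3 *: g n3.
Proof. by move=> -> <- <- <-; rewrite !scalerDl. Qed.

Fact scal_eq30 (V : lmodType F) (g : int -> V) (c1 c2 c3 : F) n1 n2 n3 :
  c1 = - c2 - c3 -> n1 = n2 -> n1 = n3 ->
  0 = c1 *: g n1 + c2 *: g n2 + c3 *: g n3.
Proof.
by move=> -> <- <-; rewrite -!scalerDl -opprD -addrA addNr scale0r.
Qed.

Fact fundamental_cases (V : lmodType F) (br : V -> V -> V -> V)
    (L M : int -> V) :
  let g (i : int + int) := match i with inl r => L r | inr r => M r end in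
  (forall y z, linear (fun x => br x y z)) ->
  (forall x z, linear (fun y => br x y z)) ->
  (forall x y, linear (fun z => br x y z)) ->
  (forall r s t, br (L r) (L s) (L t) = 0) ->
  (forall r s t, br (M r) (M s) (M t) = 0) ->
  (forall r s t, br (L r) (L s) (M t) = (s - r)%:~R *: L (r + s - t)) ->
  (forall r s t, br (L r) (M t) (L s) = (r - s)%:~R *: L (r + s - t)) ->
  (forall r s t, br (M t) (L r) (L s) = (s - r)%:~R *: L (r + s - t)) ->
  (forall r s t, br (L r) (M s) (M t) = (t - s)%:~R *: M (s + t - r)) ->
  (forall r s t, br (M s) (L r) (M t) = (s - t)%:~R *: M (s + t - r)) ->
  (forall r s t, br (M s) (M t) (L r) = (t - s)%:~R *: M (s + t - r)) ->
  forall i1 i2 i3 i4 i5,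
  br (g i1) (g i2) (br (g i3) (g i4) (g i5)) =
    br (br (g i1) (g i2) (g i3)) (g i4) (g i5)
    + br (g i3) (br (g i1) (g i2) (g i4)) (g i5)
    + br (g i3) (g i4) (br (g i1) (g i2) (g i5)).
Proof.
move=> g l1 l2 l3 b1 b2 b3 b4 b5 b6 b7 b8.
have z1 y z : br 0 y z = 0 by exact: (lin0 (l1 y z)).
have z2 x z : br x 0 z = 0 by exact: (lin0 (l2 x z)).
have z3 x y : br x y 0 = 0 by exact: (lin0 (l3 x y)).
have s1 a x y z : br (a *: x) y z = a *: br x y z.
  exact: (linZ (l1 y z) a x).
have s2 a x y z : br x (a *: y) z = a *: br x y z.
  exact: (linZ (l2 x z) a y).
have s3 a x y z : br x y (a *: z) = a *: br x y z.
  exact: (linZ (l3 x y) a z).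
move=> [a|a] [b|b] [c|c] [d|d] [e|e]; rewrite /g;
  rewrite ?(b1, b2, b3, b4, b5, b6, b7, b8) ?(z1, z2, z3, s1, s2, s3)
    ?(b1, b2, b3, b4, b5, b6, b7, b8)
    ?(scaler0, addr0, add0r, scalerA) //;
  clear -L M.
all: first [ apply: (scal_eq L) | apply: (scal_eq M)
  | apply: (scal_eq2 L) | apply: (scal_eq2 M)
  | apply: (scal_eq20 L) | apply: (scal_eq20 M)
  | apply: (scal_eq3 L) | apply: (scal_eq3 M)
  | apply: (scal_eq30 L) | apply: (scal_eq30 M)].
all: rewrite ?(rmorphB, rmorphD) /=.
all: ring.
Qed.

Fact Aod_skew12 x y z : Aod_br x y z = - Aod_br y x z.
Proof.
rewrite -scaleN1r.
have lin (V W : lmodType F) (f : V -> W) : linear f -> linear (fun x => -1 *: f x).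
  by move=> lf a u v; rewrite lf scalerDr !scalerA mulrC.
move: x; apply: malg_linear_ext => [||i].
- exact: Aod_br_linear1.
- exact/lin/Aod_br_linear2.
move: y; apply: malg_linear_ext => [||j].
- exact: Aod_br_linear2.
- exact/lin/Aod_br_linear1.
move: z; apply: malg_linear_ext => [||k].
- exact: Aod_br_linear3.
- exact/lin/Aod_br_linear3.
rewrite !Aod_brU scaleN1r; move: i j k => [r|r] [s|s] [t|t] /=;
  by rewrite ?oppr0 // -scaleNr; apply: scal_eq; ring.
Qed.

Fact Aod_skew23 x y z : Aod_br x y z = - Aod_br x z y.
Proof.
rewrite -scaleN1r.
have lin (V W : lmodType F) (f : V -> W) : linear f -> linear (fun x => -1 *: f x).
  by move=> lf a u v; rewrite lf scalerDr !scalerA mulrC.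
move: x; apply: malg_linear_ext => [||i].
- exact: Aod_br_linear1.
- exact/lin/Aod_br_linear1.
move: y; apply: malg_linear_ext => [||j].
- exact: Aod_br_linear2.
- exact/lin/Aod_br_linear3.
move: z; apply: malg_linear_ext => [||k].
- exact: Aod_br_linear3.
- exact/lin/Aod_br_linear2.
rewrite !Aod_brU scaleN1r; move: i j k => [r|r] [s|s] [t|t] /=;
  by rewrite ?oppr0 // -scaleNr; apply: scal_eq; ring.
Qed.

Fact malg_alt (K : choiceType) (W : lmodType F)
    (b : {malg F[K]} -> {malg F[K]} -> W) :
  (forall y, linear (fun x => b x y)) -> (forall x, linear (b x)) ->
  (forall x y, b x y = - b y x) -> (forall k, b (bvec F k) (bvec F k) = 0) ->
  forall x, b x x = 0.
Proof.
move=> l1 l2 sk b0 x; rewrite [x]malg_expand.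
elim/big_rec: _ => [|k y _ by0]; first exact: lin0 (l2 0).
rewrite l1 l2 b0 scaler0 add0r [b _ (_ + _)]l2 by0 addr0.
by rewrite [b y _]sk scalerN subrr.
Qed.

Fact Aod_alt12 x z : Aod_br x x z = 0.
Proof.
apply: (@malg_alt _ _ (fun x y => Aod_br x y z)) => [y|y|u v|i].
- exact: Aod_br_linear1.
- exact: Aod_br_linear2.
- exact: Aod_skew12.
move: z; apply: malg_linear_ext => [||k]; first exact: Aod_br_linear3.
  by move=> a u v; rewrite scaler0 addr0.
by rewrite Aod_brU; move: i k => [r|r] [t|t] //=; rewrite subrr scale0r.
Qed.

Fact Aod_alt23 x y : Aod_br x y y = 0.
Proof.
apply: (malg_alt (b := Aod_br x)) => [z|z|u v|i].
- exact: Aod_br_linear2.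
- exact: Aod_br_linear3.
- exact: Aod_skew23.
move: x; apply: malg_linear_ext => [||k]; first exact: Aod_br_linear1.
  by move=> a u v; rewrite scaler0 addr0.
by rewrite Aod_brU; move: i k => [r|r] [t|t] //=; rewrite subrr scale0r.
Qed.

Fact Aod_fundamental x1 x2 x3 x4 x5 :
  Aod_br x1 x2 (Aod_br x3 x4 x5) =
    Aod_br (Aod_br x1 x2 x3) x4 x5 + Aod_br x3 (Aod_br x1 x2 x4) x5
    + Aod_br x3 x4 (Aod_br x1 x2 x5).
Proof.
have l1 := Aod_br_linear1; have l2 := Aod_br_linear2.
have l3 := Aod_br_linear3.
have lc1 (V : lmodType F) (g : V -> Aod) y z : linear g ->
    linear (fun x => Aod_br (g x) y z).
  by move=> lg; apply: (lincomp (l1 y z) lg).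
have lc2 (V : lmodType F) (g : V -> Aod) x z : linear g ->
    linear (fun y => Aod_br x (g y) z).
  by move=> lg; apply: (lincomp (l2 x z) lg).
have lc3 (V : lmodType F) (g : V -> Aod) x y : linear g ->
    linear (fun z => Aod_br x y (g z)).
  by move=> lg; apply: (lincomp (l3 x y) lg).
move: x1; apply: malg_linear_ext => [||i1].
- exact: l1.
- by apply: linadd; [apply: linadd|]; [apply: lc1|apply: lc2|apply: lc3];
    apply: l1.
move: x2; apply: malg_linear_ext => [||i2].
- exact: l2.
- by apply: linadd; [apply: linadd|]; [apply: lc1|apply: lc2|apply: lc3];
    apply: l2.
move: x3; apply: malg_linear_ext => [||i3].
- by apply: lc3; apply: l1.
- by apply: linadd; [apply: linadd|]; [apply: lc1; apply: l3|apply: l1|apply: l1].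
move: x4; apply: malg_linear_ext => [||i4].
- by apply: lc3; apply: l2.
- by apply: linadd; [apply: linadd|]; [apply: l2|apply: lc2; apply: l3|apply: l2].
move: x5; apply: malg_linear_ext => [||i5].
- by apply: lc3; apply: l3.
- by apply: linadd; [apply: linadd|]; [apply: l3|apply: l3|apply: lc3; apply: l3].
have E i j k : Aod_br (bvec F i) (bvec F j) (bvec F k) = Aod_basis_br i j k.
  exact: Aod_brU.
have := fundamental_cases l1 l2 l3
  (fun r s t => E (inl r) (inl s) (inl t))
  (fun r s t => E (inr r) (inr s) (inr t))
  (fun r s t => E (inl r) (inl s) (inr t))
  (fun r s t => E (inl r) (inr t) (inl s))
  (fun r s t => E (inr t) (inl r) (inl s))
  (fun r s t => E (inl r) (inr s) (inr t))
  (fun r s t => E (inr s) (inl r) (inr t))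
  (fun r s t => E (inr s) (inr t) (inl r)).
have gE (k : int + int) : match k with
    | inl r => bvec F (inl r : int + int)
    | inr r => bvec F (inr r : int + int)
    end = bvec F k by case: k.
by move=> /(_ i1 i2 i3 i4 i5); rewrite !gE.
Qed.

HB.instance Definition _ := Lmodule_isThreeLie.Build F Aod
  Aod_br_linear1 Aod_br_linear2 Aod_br_linear3 Aod_alt12 Aod_alt23
  Aod_fundamental.

End Aomega.

Section Modules.
Variables (F : fieldType) (B : threeLieType F) (L : lieAlgType F).
Variable W : lmodType F.

Definition lie_module (phi : L -> W -> W) : Prop :=
  [/\ linear phi, forall x, linear (phi x) &
      forall x y, phi (lbr x y) = comm (phi x) (phi y)].

Definition submodule (phi : L -> W -> W) (U : set W) : Prop :=
  subspace U /\ forall x u, U u -> U (phi x u).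

(* The submodules of the module [U] are the submodules of [W] contained in
   [U]. *)
Definition irreducible (phi : L -> W -> W) (U : set W) : Prop :=
  forall N, submodule phi N -> N `<=` U -> N = [set 0] \/ N = U.

Definition reducible (phi : L -> W -> W) (U : set W) : Prop :=
  ~ irreducible phi U.

Definition indecomposable (phi : L -> W -> W) (U : set W) : Prop :=
  forall N1 N2, submodule phi N1 -> submodule phi N2 ->
    N1 `&` N2 = [set 0] -> [set u1 + u2 | u1 in N1 & u2 in N2] = U ->
    N1 = [set 0] \/ N2 = [set 0].

Record three_lie_module (rho : B -> B -> W -> W) : Prop := ThreeLieModule {
  tlm_linear1 : forall y, linear (fun x => rho x y);
  tlm_linear2 : forall x, linear (fun y => rho x y);
  tlm_alt : forall x, rho x x = 0;
  tlm_linear : forall x y, linear (rho x y);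
  tlm_comm : forall x1 x2 x3 x4,
    comm (rho x1 x2) (rho x3 x4) =
      rho [3 x1, x2, x3] x4 + rho x3 [3 x1, x2, x4];
  tlm_br : forall x1 x2 x3 x4,
    rho [3 x1, x2, x3] x4 =
      (rho x1 x2 \o rho x3 x4) + (rho x2 x3 \o rho x1 x4)
      + (rho x3 x1 \o rho x2 x4)
}.

Definition Lrho (rho : B -> B -> W -> W) : set (W -> W) :=
  lspan [set f | exists x y, f = rho x y].

Definition Lrho_center (rho : B -> B -> W -> W) : set (W -> W) :=
  [set f | Lrho rho f /\ forall g, Lrho rho g -> comm f g = 0].

(* [phi] is the linear map written rho-bar: [ad(B)] is spanned by the
   [ad(x, y)], so [phi] is determined by these two conditions. *)
Definition induced_by (rho : B -> B -> W -> W) (phi : adAlg B -> W -> W) :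
    Prop :=
  linear phi /\ forall x y, phi (adm x y) = rho x y.

Definition induced_module (phi : adAlg B -> W -> W) : Prop :=
  exists rho, [/\ three_lie_module rho, Lrho_center rho = [set 0] &
                  induced_by rho phi].

End Modules.

Section PhiMu.
Variable F : fieldType.

Local Notation A := (Aod F).

Definition adp (r : int) : adAlg A :=
  if r == 0 then adm (bL F 0) (bM F 0)
  else 2^-1 *: (adm (bL F 0) (bM F (- r)) + adm (bL F r) (bM F 0)).

Definition adq (r : int) : adAlg A :=
  if r == 0 then adm (bL F 0) (bM F 0) - adm (bL F 1) (bM F 1)
  else r%:~R^-1 *: (adm (bL F 0) (bM F (- r)) - adm (bL F r) (bM F 0)).

Definition adx (r : int) : adAlg A :=
  if r == 0 then 2^-1 *: adm (bL F 1) (bL F (- 1))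
  else r%:~R^-1 *: adm (bL F r) (bL F 0).

Definition adz (r : int) : adAlg A :=
  if r == 0 then 2^-1 *: adm (bM F 1) (bM F (- 1))
  else (- r%:~R)^-1 *: adm (bM F (- r)) (bM F 0).

Definition ad_index : choiceType := ((int + int) + (int + int))%type.

Definition ad_basis (i : ad_index) : adAlg A :=
  match i with
  | inl (inl r) => adp r
  | inl (inr r) => adq r
  | inr (inl r) => adx r
  | inr (inr r) => adz r
  end.

(* Coordinates in [ad_basis], which is a basis in characteristic zero. *)
Definition ad_coord (D : adAlg A) : {malg F[ad_index]} :=
  xget 0 [set c | mlin ad_basis c = D].

Definition Vmod : lmodType F := {malg F[F]}.

Definition bv (a : F) : Vmod := bvec F a.

Definition phi_basis (mu : F) (i : ad_index) : Vmod -> Vmod :=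
  match i with
  | inl (inl r) => mlin (fun a : F =>
      if r == 0 then a *: bv a
      else if a == 0 then (r%:~R * (mu - r%:~R)) *: bv (- r%:~R)
      else (a - r%:~R) *: bv (a - r%:~R))
  | _ => 0
  end.

Definition phi (mu : F) (D : adAlg A) : Vmod -> Vmod :=
  mlin (phi_basis mu) (ad_coord D).

Definition Uspan (a : F) : set Vmod :=
  lspan [set v | exists m : int, v = bv (a + m%:~R)].

Definition Ubar : set Vmod :=
  lspan [set v | exists2 m : int, m != 0 & v = bv m%:~R].

End PhiMu.

(* Main.v *)
From HB Require Import structures.
Require Import Defs.
From mathcomp Require Import all_boot all_algebra.
From mathcomp Require Import finmap monalg.
From mathcomp Require Import boolp classical_sets functions.
From mathcomp Require Import ring.

Set Implicit Arguments.
Unset Strict Implicit.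
Unset Printing Implicit Defensive.

Import GRing.Theory.
Local Open Scope classical_set_scope.
Local Open Scope ring_scope.

(** The coordinates of [ad(A)] can be read off from the action on the basis
    [L_t], [M_t] of the 3-Lie algebra.  With [N_t := M_{-t}], one finds
    [p_r : L_t |-> (r/2 - t) L_{t+r}, N_t |-> (r/2 - t) N_{t+r}],
    [q_r : L_t |-> - L_{t+r}, N_t |-> N_{t+r}], [x_r : N_t |-> - L_{t+r}] and
    [z_r : L_t |-> - N_{t+r}].  So [ad(A)] is the Witt algebra spanned by the
    [p_r] extended by the ideal of loops in sl_2 spanned by the [q_r], [x_r],
    [z_r]: these operators span ([adm_LL], [adm_LM], [adm_MM]), and matrix
    entries of the action give a dual family, whence independence
    ([ad_dualE]).  It follows that [phi mu] is linear with prescribed values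
    on the basis, and that it kills the ideal, so that being a module reduces
    to the Witt relation [[p_r, p_s] = (r - s) p_{r+s}] on [V]
    ([phi_basis_comm]).  Away from [v_0] this is the relation between the maps
    [v_a |-> (a - r) v_{a-r}]; at [v_0] both sides are
    [(r - s)(r + s)(mu - r - s) v_{-r-s}] ([witt_op_comm]).

    For the submodules, [p_0] acts on [v_a] as the scalar [a], and these
    scalars are pairwise distinct, so a submodule contains every [v_a]
    occurring in one of its vectors ([weight_mem]).  From [v_j] with [j]
    nonzero, [p_{j-k}] leads to a nonzero multiple of every [v_k] with [k]
    nonzero in the coset [j + Z] ([bv_step]); this gives both irreducibility
    results.  From [v_0], [p_r] leads to a nonzero multiple of [v_{-r}] as soon
    as [r] is neither [0] nor [mu], so every nonzero submodule of [U(0)]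
    contains [Ubar] ([Ubar_sub]); two of them always meet, and [U(0)] is
    indecomposable.  [V] itself is reducible since [Ubar] misses [v_0].

    Finally, a 3-Lie module [rho] inducing [phi mu] would have
    [rho(L_r, L_s) = 0] and [rho(L_r, M_s) = phi(p_{r-s})].  The second axiom
    of 3-Lie modules at [L_1, L_2, M_0, M_1] then says
    [p_2 = p_2 p_0 - p_1 p_1], whereas the two sides send [v_0] to
    [2(mu - 2) v_{-2}] and [2(mu - 1) v_{-2}] ([phi_not_induced]). *)

(** * Linear algebra *)

Lemma char0_intr_eq0 (F : fieldType) (charF0 : [pchar F] =i pred0) (m : int) :
  (m%:~R == 0 :> F) = (m == 0).
Proof.
have n0 := (pcharf0P F).1 charF0.
case: m => n; first by rewrite -pmulrn n0.
by rewrite NegzE rmorphN /= !oppr_eq0 -pmulrn n0.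
Qed.

Lemma mcoeff_bvec (F : fieldType) (K : choiceType) (k j : K) :
  (bvec F k)@_j = (k == j)%:R.
Proof. by rewrite bvec.unlock mcoeffU. Qed.

Lemma mcoeff_linear (F : fieldType) (K : choiceType) (k : K) :
  linear (fun x : {malg F[K]} => x@_k : F^o).
Proof. by move=> a x y; rewrite mcoeffD mcoeffZ. Qed.

Section LinearTools.
Variable F : fieldType.

Lemma subspace_bvec (K : choiceType) (U : set {malg F[K]}) :
  subspace U -> (forall k, U (bvec F k)) -> forall x, U x.
Proof.
move=> [U0 UD] Ub x; rewrite [x]malg_expand; elim/big_rec: _ => // k y _ Uy.
exact: UD.
Qed.

Lemma mlin_image_subspace (K : choiceType) (V : lmodType F) (f : K -> V) :
  subspace [set v | exists c, v = mlin f c].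
Proof.
split=> [|a _ _ [c ->] [d ->]]; first by exists 0; rewrite raddf0.
by exists (a *: c + d); rewrite linearP.
Qed.

Lemma preim_subspace (V W : lmodType F) (f : V -> W) (U : set W) :
  linear f -> subspace U -> subspace [set v | U (f v)].
Proof.
move=> lf [U0 UD]; split=> [|a u v Uu Uv] /=; first by rewrite (lin0 lf).
by rewrite lf; apply: UD.
Qed.

Lemma subspaceZ (V : lmodType F) (U : set V) a v :
  subspace U -> U v -> U (a *: v).
Proof. by move=> [U0 UD] Uv; rewrite -[_ *: v]addr0; apply: UD. Qed.

Lemma comm_linearl (W : lmodType F) (h : W -> W) :
  linear h -> linear (fun f : W -> W => comm f h).
Proof.
move=> lh a f g; apply/funext => v; rewrite /comm !fctE /= lh.
by rewrite scalerBr opprD addrACA.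
Qed.

Lemma comm_linearr (W : lmodType F) (h : W -> W) :
  linear h -> linear (comm h).
Proof.
move=> lh a f g; apply/funext => v; rewrite /comm !fctE /= lh.
by rewrite scalerBr opprD addrACA.
Qed.

(** The next three lemmas collect combinations of members of one family whose
    indices agree only up to a ring identity. *)
Lemma comb2_eq (T : Type) (V : lmodType F) (g : T -> V) a b c k l n :
  k = n -> l = n -> a + b = c -> a *: g k + b *: g l = c *: g n.
Proof. by move=> -> -> <-; rewrite scalerDl. Qed.

Lemma scale_add2_eq (T : Type) (V : lmodType F) (g : T -> V) a b c d k l n :
  k = n -> l = n -> a * (b + c) = d ->
  a *: (b *: g k + c *: g l) = d *: g n.
Proof. by move=> -> -> <-; rewrite -scalerDl scalerA. Qed.

Lemma scale_sub2_eq (T : Type) (V : lmodType F) (g : T -> V) a b c d k l n :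
  k = n -> l = n -> a * (b - c) = d ->
  a *: (b *: g k - c *: g l) = d *: g n.
Proof. by move=> -> -> <-; rewrite -scalerBl scalerA. Qed.

End LinearTools.

(** * The action of ad(A) on A *)

Section Action.
Variable F : fieldType.
Local Notation A := (Aod F).
Implicit Types (D E : adAlg A).

Lemma adval_linear D : linear D.
Proof. exact/ad_linear/asboolP/advalP. Qed.

Lemma adAlg_ext D E :
  (forall t, D (bL F t) = E (bL F t)) -> (forall t, D (bM F t) = E (bM F t)) ->
  D = E.
Proof.
move=> eL eM; apply/val_inj/funext => x /=; move: x.
by apply: malg_linear_ext => [||[t|t]];
  [exact: adval_linear..|exact: eL|exact: eM].
Qed.

Lemma advalD D E x : (D + E) x = D x + E x. Proof. by []. Qed.
Lemma advalN D x : (- D) x = - D x. Proof. by []. Qed.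
Lemma advalZ a D x : (a *: D) x = a *: D x. Proof. by []. Qed.

Lemma adm_bvec (i j k : int + int) :
  adm (bvec F i : A) (bvec F j : A) (bvec F k) = Aod_basis_br F i j k.
Proof. exact: Aod_brU. Qed.

Definition adE := (advalD, advalN, advalZ, adm_bvec).

Hypothesis charF0 : [pchar F] =i pred0.

Let int_neq0 (m : int) : m != 0 -> m%:~R != 0 :> F.
Proof. by rewrite char0_intr_eq0. Qed.

Lemma two_neq0 : 2 != 0 :> F.
Proof. exact: (@int_neq0 2). Qed.

(** The values below also hold at [r = 0], where the basis elements are defined
    by separate formulas; hence each proof splits on [r = 0]. *)
Lemma adpL r t : adp F r (bL F t) = (2^-1 * r%:~R - t%:~R) *: bL F (t + r).
Proof.
have t0 := two_neq0.
rewrite /adp; case: eqVneq => [->|/int_neq0 r0]; rewrite !adE /=.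
  by apply: scal_eq; ring.
by apply: (scale_add2_eq (bL F)); rewrite ?rmorphB /=; [ring|ring|field].
Qed.

Lemma adpM r t : adp F r (bM F t) = (2^-1 * r%:~R + t%:~R) *: bM F (t - r).
Proof.
have t0 := two_neq0.
rewrite /adp; case: eqVneq => [->|/int_neq0 r0]; rewrite !adE /=.
  by apply: scal_eq; ring.
by apply: (scale_add2_eq (bM F)); rewrite ?rmorphB ?rmorphN /=;
  [ring|ring|field].
Qed.

Lemma adqL r t : adq F r (bL F t) = - bL F (t + r).
Proof.
rewrite -[RHS]scaleN1r /adq; case: eqVneq => [->|/int_neq0 r0]; rewrite !adE /=.
  by rewrite -[LHS]scale1r; apply: (scale_sub2_eq (bL F)); ring.
by apply: (scale_sub2_eq (bL F)); rewrite ?rmorphB /=; [ring|ring|field].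
Qed.

Lemma adqM r t : adq F r (bM F t) = bM F (t - r).
Proof.
rewrite -[RHS]scale1r /adq; case: eqVneq => [->|/int_neq0 r0]; rewrite !adE /=.
  by rewrite -[LHS]scale1r; apply: (scale_sub2_eq (bM F)); ring.
by apply: (scale_sub2_eq (bM F)); rewrite ?rmorphB ?rmorphN /=;
  [ring|ring|field].
Qed.

Lemma adxL r t : adx F r (bL F t) = 0.
Proof. by rewrite /adx; case: ifP => _; rewrite !adE /= scaler0. Qed.

Lemma adxM r t : adx F r (bM F t) = - bL F (r - t).
Proof.
have t0 := two_neq0.
rewrite -[RHS]scaleN1r /adx.
case: eqVneq => [->|/int_neq0 r0]; rewrite !adE /= scalerA.
  by apply: scal_eq; [field|ring].
by apply: scal_eq; [rewrite ?rmorphB /=; field|ring].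
Qed.

Lemma adzL r t : adz F r (bL F t) = - bM F (- t - r).
Proof.
have t0 := two_neq0.
rewrite -[RHS]scaleN1r /adz.
case: eqVneq => [->|/int_neq0 r0]; rewrite !adE /= scalerA.
  by apply: scal_eq; [field|ring].
by apply: scal_eq; [rewrite ?rmorphB ?rmorphN /=; field; rewrite oppr_eq0|ring].
Qed.

Lemma adzM r t : adz F r (bM F t) = 0.
Proof. by rewrite /adz; case: ifP => _; rewrite !adE /= scaler0. Qed.

Definition ad_basisE := (adpL, adpM, adqL, adqM, adxL, adxM, adzL, adzM).

Lemma adm_LL r s : adm (bL F r) (bL F s) = (r - s)%:~R *: adx F (r + s).
Proof.
apply: adAlg_ext => t; rewrite advalZ ad_basisE ?adE /= ?scaler0 //.
by rewrite scalerN -scaleNr; apply: scal_eq; ring.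
Qed.

Lemma adm_MM r s : adm (bM F r) (bM F s) = (r - s)%:~R *: adz F (- (r + s)).
Proof.
apply: adAlg_ext => t; rewrite advalZ ad_basisE ?adE /= ?scaler0 //.
by rewrite scalerN -scaleNr; apply: scal_eq; ring.
Qed.

(** The coefficients are found from the values at [L_t]: [p_n] and [q_n] with
    [n := r - s] give [(n/2 - t) - c], which is [r - t] for
    [c = - (r + s)/2]. *)
Lemma adm_LM r s : adm (bL F r) (bM F s) =
  adp F (r - s) - (2^-1 * (r + s)%:~R) *: adq F (r - s).
Proof.
have t0 := two_neq0.
apply: adAlg_ext => t; rewrite advalD advalN advalZ !ad_basisE ?adE /=.
  rewrite scalerN opprK -scalerDl; apply: scal_eq; last by ring.
  by rewrite !(rmorphB, rmorphD) /=; field.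
rewrite -scalerBl; apply: scal_eq; last by ring.
by rewrite !(rmorphB, rmorphD) /=; field.
Qed.

End Action.

(** * The basis of ad(A) *)

(** Locked, so that coordinates are computed by linearity only, never by
    unfolding the vectors. *)
HB.lock Definition Aod_coef (F : fieldType) (k : int + int) (x : Aod F) : F :=
  (x : {malg F[(int + int)%type]})@_k.

Section Basis.
Variable F : fieldType.
Local Notation A := (Aod F).

Lemma Aod_coefD k (x y : A) : Aod_coef k (x + y) = Aod_coef k x + Aod_coef k y.
Proof. by rewrite Aod_coef.unlock mcoeffD. Qed.

Lemma Aod_coefZ k a (x : A) : Aod_coef k (a *: x) = a * Aod_coef k x.
Proof. by rewrite Aod_coef.unlock mcoeffZ. Qed.

Lemma Aod_coef0 k : Aod_coef k (0 : A) = 0.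
Proof. by rewrite Aod_coef.unlock mcoeff0. Qed.

Lemma Aod_coefN k (x : A) : Aod_coef k (- x) = - Aod_coef k x.
Proof. by rewrite Aod_coef.unlock mcoeffN. Qed.

Lemma Aod_coefU k j : Aod_coef k (bvec F j : A) = (j == k)%:R.
Proof. by rewrite Aod_coef.unlock mcoeff_bvec. Qed.

Hypothesis charF0 : [pchar F] =i pred0.

(** The dual family of [ad_basis], read off from matrix entries.  On [L_t],
    [p_r] and [q_r] both shift to [L_{t+r}], with coefficients [r/2 - t] and
    [-1]: the difference of the entries at [t = 0] and [t = 1] isolates the
    coordinate on [p_r], and the entry at [t = 0] then yields that on [q_r]. *)
Definition ad_dual (i : ad_index) (D : adAlg A) : F^o :=
  let cL r t : F := Aod_coef (inl r) (D (bL F t)) in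
  match i with
  | inl (inl r) => cL r 0 - cL (r + 1) 1
  | inl (inr r) => 2^-1 * r%:~R * (cL r 0 - cL (r + 1) 1) - cL r 0
  | inr (inl r) => - Aod_coef (inl r) (D (bM F 0))
  | inr (inr r) => - Aod_coef (inr (- r)) (D (bL F 0))
  end.

Lemma ad_dual_linear i : linear (ad_dual i).
Proof.
move: i => [[r|r]|[r|r]] a D E; rewrite /ad_dual
  !advalD !advalZ !Aod_coefD !Aod_coefZ
  /GRing.scale /=; ring.
Qed.

Lemma eq_inl (T1 T2 : eqType) (a b : T1) :
  (inl a == inl b :> T1 + T2) = (a == b).
Proof. by []. Qed.

Lemma eq_inr (T1 T2 : eqType) (a b : T2) :
  (inr a == inr b :> T1 + T2) = (a == b).
Proof. by []. Qed.

Lemma ad_dualE i j : ad_dual i (ad_basis F j) = (j == i)%:R.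
Proof.
move: i j => [[r|r]|[r|r]] [[s|s]|[s|s]]; rewrite /ad_dual /=
  ?(ad_basisE charF0) ?Aod_coefZ ?Aod_coefN ?Aod_coefZ ?Aod_coef0 ?Aod_coefU
  ?eq_inl ?eq_inr ?eq_inl ?add0r ?(addrC 1) ?(inj_eq (addIr 1)) ?oppr0 ?sub0r
  ?addr0 ?(inj_eq oppr_inj).
all: by [case: (eqVneq s r) => [->|_]; rewrite /=; ring | rewrite /=; ring].
Qed.

Lemma ad_dual_mlin i c : ad_dual i (mlin (ad_basis F) c) = c@_i.
Proof.
move: c; apply: malg_linear_ext => [||j].
- by apply: lincomp; [apply: ad_dual_linear|apply: mlin_linear].
- exact: mcoeff_linear.
by rewrite mlinU ad_dualE mcoeff_bvec.
Qed.

Lemma adm_skew x y : adm x y = (-1) *: adm y x :> adAlg A.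
Proof.
by apply/val_inj/funext => z; rewrite /= scaleN1r; apply: Aod_skew12.
Qed.

Lemma adm_linear1 y : linear (fun x : A => adm x y).
Proof. by move=> a u v; apply/val_inj/funext => z; apply: Aod_br_linear1. Qed.

Lemma adm_linear2 x : linear (fun y : A => adm x y).
Proof. by move=> a u v; apply/val_inj/funext => z; apply: Aod_br_linear2. Qed.

(** By trilinearity it suffices to treat the brackets of basis vectors. *)
Lemma ad_basis_span (D : adAlg A) : exists c, D = mlin (ad_basis F) c.
Proof.
pose U : set (adAlg A) := [set D | exists c, D = mlin (ad_basis F) c].
have sU : subspace U by apply: mlin_image_subspace.
have Ub i : U (ad_basis F i) by exists (bvec F i); rewrite mlinU.
have Ubb (i j : int + int) : U (adm (bvec F i : A) (bvec F j : A)).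
  case: i j => r [] s.
  - rewrite (adm_LL charF0); apply: subspaceZ => //; exact: (Ub (inr (inl _))).
  - rewrite (adm_LM charF0) addrC -scaleNr.
    by apply: sU.2; [exact: (Ub (inl (inr _)))|exact: (Ub (inl (inl _)))].
  - rewrite adm_skew; apply: subspaceZ => //.
    rewrite (adm_LM charF0) addrC -scaleNr.
    by apply: sU.2; [exact: (Ub (inl (inr _)))|exact: (Ub (inl (inl _)))].
  - rewrite (adm_MM charF0); apply: subspaceZ => //; exact: (Ub (inr (inr _))).
have Uxy x y : U (adm x y).
  move: x; apply: subspace_bvec => [|i].
    exact: preim_subspace (adm_linear1 y) sU.
  move: y; apply: subspace_bvec => [|j]; last exact: Ubb.
  exact: preim_subspace (adm_linear2 _) sU.
suff /(_ _ (asboolW (advalP D))) [c Dc] :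
    ad_set (B := A) `<=` [set f | exists c, f = adval (mlin (ad_basis F) c)].
  by exists c; apply/val_inj.
apply: lspan_ind => [|_ [x [y ->]]].
  split=> [|a _ _ [c ->] [d ->]]; first by exists 0; rewrite raddf0.
  by exists (a *: c + d); rewrite linearP.
by have [c e] := Uxy x y; exists c; rewrite -e.
Qed.

(** Independence of the basis, by evaluation of the dual family, makes the
    coordinates chosen by [ad_coord] unique. *)
Lemma ad_coordK c : ad_coord (mlin (ad_basis F) c) = c.
Proof.
have /= e : [set d | mlin (ad_basis F) d = mlin (ad_basis F) c]
    (ad_coord (mlin (ad_basis F) c)) by apply: xgetPex; exists c.
by apply/malgP => i; rewrite -!ad_dual_mlin e.
Qed.

Lemma phi_mlin mu c : phi mu (mlin (ad_basis F) c) = mlin (phi_basis mu) c.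
Proof. by rewrite /phi ad_coordK. Qed.

Lemma phi_ad_basis mu i : phi mu (ad_basis F i) = phi_basis mu i.
Proof. by rewrite -[ad_basis F i]mlinU phi_mlin mlinU. Qed.

Lemma phi_linear mu : linear (phi (F := F) mu).
Proof.
move=> a D E; have [c ->] := ad_basis_span D; have [d ->] := ad_basis_span E.
by rewrite -linearP !phi_mlin linearP.
Qed.

Lemma phi_linearr mu D : linear (phi (F := F) mu D).
Proof.
have [c ->] := ad_basis_span D; rewrite phi_mlin.
have -> : mlin (phi_basis mu) c = fun v => mlin (phi_basis mu ^~ v) c.
  by apply/funext => v; rewrite /mlin fct_sumE.
apply: mlin_linear_fun => -[[r|r]|[r|r]] a u v /=; last 3 first.
- by rewrite scaler0 addr0.
- by rewrite scaler0 addr0.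
- by rewrite scaler0 addr0.
exact: mlin_linear.
Qed.

End Basis.

(** * The Lie bracket of ad(A) *)

Section Bracket.
Variable F : fieldType.
Local Notation A := (Aod F).

(** The bracket of two basis elements is always a multiple [c *: b_k] of a third
    one; this is the pair [(c, k)]. *)
Definition ad_struct (i j : ad_index) : F * ad_index :=
  match i, j with
  | inl (inl r), inl (inl s) => ((r - s)%:~R, inl (inl (r + s)))
  | inl (inl r), inl (inr s) => (- s%:~R, inl (inr (r + s)))
  | inl (inl r), inr (inl s) => (- s%:~R, inr (inl (r + s)))
  | inl (inl r), inr (inr s) => (- s%:~R, inr (inr (r + s)))
  | inl (inr s), inl (inl r) => (s%:~R, inl (inr (s + r)))
  | inl (inr r), inl (inr s) => (0, inl (inr (r + s)))
  | inl (inr r), inr (inl s) => (-2, inr (inl (r + s)))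
  | inl (inr r), inr (inr s) => (2, inr (inr (r + s)))
  | inr (inl s), inl (inl r) => (s%:~R, inr (inl (s + r)))
  | inr (inl r), inl (inr s) => (2, inr (inl (r + s)))
  | inr (inl r), inr (inl s) => (0, inr (inl (r + s)))
  | inr (inl r), inr (inr s) => (-1, inl (inr (r + s)))
  | inr (inr s), inl (inl r) => (s%:~R, inr (inr (s + r)))
  | inr (inr r), inl (inr s) => (-2, inr (inr (r + s)))
  | inr (inr r), inr (inl s) => (1, inl (inr (r + s)))
  | inr (inr r), inr (inr s) => (0, inr (inr (r + s)))
  end.

(** Stated for abstract operators: the commutation relations follow from the
    action formulas alone, and hold for any [h] in place of [1/2], so that all
    the coefficients can be compared by polynomial identities. *)
Lemma ad_struct_cases (V : lmodType F) (h : F) (p q x z : int -> V -> V)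
    (L M : int -> V) :
  let b (i : ad_index) := match i with
    | inl (inl r) => p r | inl (inr r) => q r
    | inr (inl r) => x r | inr (inr r) => z r end in
  (forall i, linear (b i)) ->
  (forall r t, p r (L t) = (h * r%:~R - t%:~R) *: L (t + r)) ->
  (forall r t, p r (M t) = (h * r%:~R + t%:~R) *: M (t - r)) ->
  (forall r t, q r (L t) = - L (t + r)) ->
  (forall r t, q r (M t) = M (t - r)) ->
  (forall r t, x r (L t) = 0) ->
  (forall r t, x r (M t) = - L (r - t)) ->
  (forall r t, z r (L t) = - M (- t - r)) ->
  (forall r t, z r (M t) = 0) ->
  forall i j (c : bool) t, let v := if c then L t else M t in
  b i (b j v) - b j (b i v) = (ad_struct i j).1 *: b (ad_struct i j).2 v.
Proof.
move=> b lb pL pM qL qM xL xM zL zM i j c t /=.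
have bZ i' a v : b i' (a *: v) = a *: b i' v by apply: linZ.
have b0 i' : b i' 0 = 0 by apply: lin0.
have pZ r a v : p r (a *: v) = a *: p r v := bZ (inl (inl r)) a v.
have p0 r : p r 0 = 0 := b0 (inl (inl r)).
have qZ r a v : q r (a *: v) = a *: q r v := bZ (inl (inr r)) a v.
have q0 r : q r 0 = 0 := b0 (inl (inr r)).
have xZ r a v : x r (a *: v) = a *: x r v := bZ (inr (inl r)) a v.
have x0 r : x r 0 = 0 := b0 (inr (inl r)).
have zZ r a v : z r (a *: v) = a *: z r v := bZ (inr (inr r)) a v.
have z0 r : z r 0 = 0 := b0 (inr (inr r)).
have {}qL r t' : q r (L t') = -1 *: L (t' + r) by rewrite scaleN1r.
have {}qM r t' : q r (M t') = 1 *: M (t' - r) by rewrite scale1r.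
have {}xM r t' : x r (M t') = -1 *: L (r - t') by rewrite scaleN1r.
have {}zL r t' : z r (L t') = -1 *: M (- t' - r) by rewrite scaleN1r.
have bE := (pL, pM, qL, qM, xL, xM, zL, zM).
have zE := (pZ, qZ, xZ, zZ, p0, q0, x0, z0).
move: i j c => [[r|r]|[r|r]] [[s|s]|[s|s]] []; rewrite /b /= !bE ?zE ?bE
  ?scaler0 ?subr0 ?sub0r ?scalerA -?scaleNr //.
all: first [apply: (comb2_eq L) | apply: (comb2_eq M) | apply: (scal_eq L)
  | apply: (scal_eq M) | by rewrite mul0r scale0r].
all: rewrite ?(rmorphB, rmorphD) /=.
all: ring.
Qed.

Hypothesis charF0 : [pchar F] =i pred0.

Lemma lbrE (D E : adAlg A) x : (lbr D E) x = D (E x) - E (D x).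
Proof. by []. Qed.

Lemma ad_structE i j :
  lbr (ad_basis F i) (ad_basis F j) =
    (ad_struct i j).1 *: ad_basis F (ad_struct i j).2.
Proof.
pose b (i : ad_index) : A -> A := match i with
  | inl (inl r) => adp F r | inl (inr r) => adq F r
  | inr (inl r) => adx F r | inr (inr r) => adz F r end.
have bE k : adval (ad_basis F k) = b k by case: k => -[].
have := @ad_struct_cases A 2^-1 (adp F) (adq F) (adx F) (adz F) (bL F) (bM F).
move=> /(_ _ (adpL charF0) (adpM charF0) (adqL charF0) (adqM charF0)
  (@adxL F) (adxM charF0) (adzL charF0) (@adzM F) i j) E.
have {}E : forall (c : bool) t, let v := if c then bL F t else bM F t in
    b i (b j v) - b j (b i v) = (ad_struct i j).1 *: b (ad_struct i j).2 v.
  by apply: E => k; rewrite -[X in linear X]bE; apply: adval_linear.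
apply: adAlg_ext => t; rewrite lbrE advalZ !bE.
  exact: (E true).
exact: (E false).
Qed.

End Bracket.

(** * The Witt operators on V *)

Section Witt.
Variable F : fieldType.
Hypothesis charF0 : [pchar F] =i pred0.

Definition witt_op mu r : Vmod F -> Vmod F := phi_basis mu (inl (inl r)).

Lemma witt_op_linear mu r : linear (witt_op mu r).
Proof. exact: mlin_linear. Qed.

Lemma witt_opE mu r (a : F) : a != 0 ->
  witt_op mu r (bv a) = (a - r%:~R) *: bv (a - r%:~R).
Proof.
move=> a0; rewrite /witt_op /phi_basis mlinU (negPf a0).
by case: eqVneq => [->|//]; rewrite subr0.
Qed.

Lemma witt_op0 mu r :
  witt_op mu r (bv 0) = (r%:~R * (mu - r%:~R)) *: bv (- r%:~R : F).
Proof.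
rewrite /witt_op /phi_basis mlinU eqxx.
by case: eqVneq => [->|//]; rewrite mul0r !scale0r.
Qed.

(** The scalar [b - w] by which [p_w] multiplies [v_b] vanishes exactly when
    [p_w] reaches [v_0]; hence the exceptional formula at [v_0] matters only for
    vectors that start at [v_0].  There the relation is the identity
    [s (mu - s) - r (mu - r) = - (r - s) (mu - (r + s))]. *)
Lemma witt_op_comm mu r s : comm (witt_op mu r) (witt_op mu s) =
  (r - s)%:~R *: witt_op mu (r + s).
Proof.
have lin a b := lincomp (witt_op_linear mu a) (witt_op_linear mu b).
have lN (f : Vmod F -> Vmod F) : linear f -> linear (fun v => - f v).
  by move=> lf a u v; rewrite lf opprD scalerN.
apply/funext; apply: malg_linear_ext => [||a].
- exact: linadd (lin _ _) (lN _ (lin _ _)).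
- move=> a u v /=; rewrite !fctE witt_op_linear scalerDr !scalerA.
  by rewrite [_ * a]mulrC.
rewrite -/(bv a) /comm fctE.
have scal_opE u b c : witt_op mu u (c *: bv b) = c *: witt_op mu u (bv b).
  exact: linZ (witt_op_linear mu u) _ _.
have step u w b : b != 0 -> witt_op mu u (witt_op mu w (bv b)) =
    ((b - w%:~R) * (b - w%:~R - u%:~R)) *: bv (b - w%:~R - u%:~R).
  move=> b0; rewrite witt_opE // scal_opE.
  have [->|bw] := eqVneq (b - w%:~R) 0; first by rewrite mul0r !scale0r.
  by rewrite witt_opE // scalerA.
have step0 u w : witt_op mu u (witt_op mu w (bv 0)) =
    (w%:~R * (mu - w%:~R) * (- w%:~R - u%:~R)) *: bv (- w%:~R - u%:~R : F).
  rewrite witt_op0 scal_opE; have [->|w0] := eqVneq w 0.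
    by rewrite !mul0r !scale0r.
  by rewrite witt_opE ?scalerA // oppr_eq0 char0_intr_eq0.
have [->|a0] := eqVneq a 0.
  rewrite !step0 witt_op0 scalerA -scaleNr.
  by apply: (comb2_eq (bv (F := F))); rewrite ?(rmorphD, rmorphB) /=; ring.
rewrite !step // witt_opE // scalerA -scaleNr.
by apply: (comb2_eq (bv (F := F))); rewrite ?(rmorphD, rmorphB) /=; ring.
Qed.

(** Outside the Witt part both sides vanish: the [q_r], [x_r], [z_r] span an
    ideal on which [phi_basis] is zero. *)
Lemma phi_basis_comm mu i j :
  phi mu (lbr (ad_basis F i) (ad_basis F j)) =
    comm (phi_basis mu i) (phi_basis mu j).
Proof.
have lb k : linear (phi_basis mu k).
  by rewrite -(phi_ad_basis charF0); apply: (phi_linearr charF0).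
rewrite (ad_structE charF0) (linZ (phi_linear charF0 mu)) (phi_ad_basis charF0).
have c0 (f : Vmod F -> Vmod F) : linear f -> comm f 0 = 0.
  by move=> lf; apply/funext => v; rewrite /comm /= (lin0 lf) subrr.
have c1 (f : Vmod F -> Vmod F) : linear f -> comm 0 f = 0.
  by move=> lf; apply/funext => v; rewrite /comm /= (lin0 lf) subrr.
have [li lj] := (lb i, lb j).
move: i j li lj => [[r|r]|[r|r]] [[s|s]|[s|s]] li lj;
  rewrite [phi_basis mu (ad_struct _ _ _).2]/= ?[phi_basis mu (inl (inr _))]/=
   ?[phi_basis mu (inr _)]/= ?c0 ?c1 ?scaler0 //.
exact/esym/witt_op_comm.
Qed.

Lemma phi_lie_module mu : lie_module (phi (F := F) mu).
Proof.
split=> [||D E]; [exact: phi_linear|exact: phi_linearr|].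
have [c ->] := ad_basis_span charF0 D; have [d ->] := ad_basis_span charF0 E.
have lp := phi_linear charF0 mu.
move: c; apply: malg_linear_ext => [||i].
- exact: lincomp lp (lincomp (lbr_linear1 _) (mlin_linear _)).
- apply: (lincomp (f := fun f => comm f _)).
    exact/comm_linearl/phi_linearr.
  exact: lincomp lp (mlin_linear _).
rewrite mlinU; move: d; apply: malg_linear_ext => [||j].
- exact: lincomp lp (lincomp (lbr_linear2 _) (mlin_linear _)).
- apply: lincomp; first exact/comm_linearr/phi_linearr.
  exact: lincomp lp (mlin_linear _).
by rewrite mlinU phi_basis_comm !(phi_ad_basis charF0).
Qed.
End Witt.

(** * Submodules spanned by basis vectors *)

Section Submodules.
Variable F : fieldType.

Definition vcoef (k : F) (x : Vmod F) : F := (x : {malg F[F]})@_k.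

Definition supported (S : set F) : set (Vmod F) :=
  [set x | forall k, vcoef k x != 0 -> S k].

Lemma vcoef_linear k : linear (vcoef k : Vmod F -> F^o).
Proof. exact: mcoeff_linear. Qed.

Lemma vcoefP (x y : Vmod F) : (forall k, vcoef k x = vcoef k y) -> x = y.
Proof. by move=> e; apply/malgP. Qed.

Lemma vcoef_bv (j k : F) : vcoef j (bv k) = (k == j)%:R.
Proof. exact: mcoeff_bvec. Qed.

Lemma lspan_bv (S : set F) :
  lspan [set v | exists2 k, S k & v = bv k] = supported S.
Proof.
have [s0 sD] := lspan_subspace [set v | exists2 k : F, S k & v = bv k].
apply/seteqP; split=> [|x Sx].
  apply: lspan_ind => [|_ [k Sk ->] j]; last first.
    by rewrite vcoef_bv; case: (eqVneq k j) => [<-|_]; rewrite ?eqxx.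
  split=> [k|a u v Su Sv k]; first by rewrite /vcoef mcoeff0 eqxx.
  rewrite vcoef_linear; have [u0|/Su//] := eqVneq (vcoef k u) 0.
  by rewrite u0 scaler0 add0r => /Sv.
rewrite [x]malg_expand big_seq; elim/big_rec: _ => // k y kx ysp.
apply: sD => //; apply: lspan_gen; exists k => //.
by apply: Sx; rewrite /vcoef mcoeff_neq0.
Qed.

Lemma supported_subspace S : subspace (supported S).
Proof. by rewrite -lspan_bv; apply: lspan_subspace. Qed.

Lemma supportedZ (S : set F) a v : supported S v -> supported S (a *: v).
Proof. exact: subspaceZ (supported_subspace S). Qed.

Lemma supported_bv (S : set F) k : S k -> supported S (bv k).
Proof.
by move=> Sk j; rewrite vcoef_bv; case: (eqVneq k j) => [<-|_]; rewrite ?eqxx.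
Qed.

Lemma supported_sub (S : set F) (U : set (Vmod F)) :
  subspace U -> (forall k, S k -> U (bv k)) -> supported S `<=` U.
Proof.
by move=> sU SU; rewrite -lspan_bv; apply: lspan_ind => // _ [k /SU ? ->].
Qed.

Lemma UspanE (a : F) : Uspan a =
  supported [set k | exists m : int, k = a + m%:~R].
Proof.
rewrite -lspan_bv; congr lspan; apply/seteqP.
split=> [_ [m ->]|_ [_ [m ->] ->]].
  by exists (a + m%:~R) => //; exists m.
by exists m.
Qed.

Lemma UbarE : @Ubar F = supported [set k | exists2 m : int, m != 0 & k = m%:~R].
Proof.
rewrite -lspan_bv; congr lspan; apply/seteqP.
split=> [_ [m m0 ->]|_ [_ [m m0 ->] ->]]; last by exists m.
by exists m%:~R => //; exists m.
Qed.

Hypothesis charF0 : [pchar F] =i pred0.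
Variable mu : F.

(** The other basis elements act by zero. *)
Lemma submoduleP (U : set (Vmod F)) : submodule (phi mu) U <->
  subspace U /\ forall r v, U v -> U (witt_op mu r v).
Proof.
split=> -[sU opU]; split=> //.
  by move=> r v Uv; rewrite /witt_op -(phi_ad_basis charF0); apply: opU.
move=> D v Uv; have [c ->] := ad_basis_span charF0 D.
rewrite (phi_mlin charF0).
have lev : linear (fun c => mlin (phi_basis mu) c v).
  by move=> a c' d; rewrite linearP.
move: c; apply: subspace_bvec; first exact: preim_subspace lev sU.
move=> i; rewrite /= mlinU; move: i => [[r|r]|[r|r]];
  [exact: opU|exact: sU.1..].
Qed.

Lemma vcoef_witt_op0 k x : vcoef k (witt_op mu 0 x) = k * vcoef k x.
Proof.
move: x; apply: (malg_linear_ext (W := F^o)).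
- exact: lincomp (vcoef_linear k) (witt_op_linear mu 0).
- move=> a x y; rewrite vcoef_linear mulrDr; congr (_ + _).
  by rewrite /GRing.scale /= mulrCA.
move=> j; rewrite -/(bv j) /witt_op /phi_basis mlinU eqxx.
rewrite (linZ (vcoef_linear k)) vcoef_bv.
by case: eqVneq => [->|] //; rewrite !mulr0 scaler0.
Qed.

(** A subspace invariant under [p_0] is invariant under every polynomial in
    [p_0].  The product of the [p_0 - i], for [i] in the support of [x] and
    different from [k], kills every [v_i] in the support of [x] except [v_k],
    since the eigenvalues of [p_0] are pairwise distinct. *)
Lemma weight_mem N x k : submodule (phi mu) N -> N x -> vcoef k x != 0 ->
  N (bv k).
Proof.
move=> /submoduleP [sN opN] Nx xk.
have prod s : exists2 y, N y &
    forall j, vcoef j y = (\prod_(i <- s) (j - i)) * vcoef j x.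
  elim: s => [|i s [y Ny yE]]; first by exists x => // j; rewrite big_nil mul1r.
  exists ((- i) *: y + witt_op mu 0 y); first by apply: sN.2 => //; apply: opN.
  move=> j; rewrite vcoef_linear vcoef_witt_op0 yE big_cons.
  by rewrite -mulrA mulrBl /GRing.scale /= mulNr addrC.
have [y Ny yE] := prod [seq i <- msupp (x : {malg F[F]}) | i != k].
pose c := vcoef k y.
have c0 : c != 0.
  rewrite /c yE mulf_neq0 // prodf_seq_neq0; apply/allP => i.
  by rewrite mem_filter subr_eq0 eq_sym => /andP[].
have -> : bv k = c^-1 *: y; last exact: subspaceZ.
apply: vcoefP => j; rewrite (linZ (vcoef_linear j)) vcoef_bv.
case: eqVneq => [<-|kj]; first by rewrite /GRing.scale /= mulVf.
rewrite yE; apply/esym/eqP; rewrite mulf_eq0; apply/orP; right; apply/eqP.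
have [->|xj] := eqVneq (vcoef j x) 0; first by rewrite mulr0.
rewrite (big_rem j) /= ?subrr ?mul0r // mem_filter eq_sym kj.
by rewrite -mcoeff_neq0.
Qed.

Lemma nonzero_submodule_bv N : submodule (phi mu) N -> N <> [set 0] ->
  exists2 k, N (bv k) & forall S, N `<=` supported S -> S k.
Proof.
move=> sN N0.
have [x Nx x0] : exists2 x, N x & x <> 0.
  apply: contrapT => nx; apply: N0; apply/seteqP; split=> [x Nx|_ ->].
    by apply: contrapT => x0; apply: nx; exists x.
  by have [[]] := sN.
have [k xk] : exists k, vcoef k x != 0.
  apply: contrapT => nk; apply: x0; apply: vcoefP => k.
  rewrite /(vcoef _ 0) mcoeff0; apply: contrapT => /eqP xk.
  by apply: nk; exists k.
by exists k; [exact: weight_mem xk|move=> S /(_ _ Nx); apply].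
Qed.

Lemma bv_step N (j k : F) (r : int) : submodule (phi mu) N -> N (bv j) ->
  j != 0 -> k != 0 -> k = j - r%:~R -> N (bv k).
Proof.
move=> /submoduleP [sN opN] Nj j0 k0 kE.
have := subspaceZ k^-1 sN (opN r _ Nj).
by rewrite witt_opE // -kE scalerA mulVf // scale1r.
Qed.

Lemma irreducible_supported S :
  (forall N j k, submodule (phi mu) N -> S j -> S k -> N (bv j) -> N (bv k)) ->
  irreducible (phi mu) (supported S).
Proof.
move=> trS N sN NS; have [|N0] := pselect (N = [set 0]); first by left.
right; apply/seteqP; split=> //.
have [j Nj /(_ _ NS) Sj] := nonzero_submodule_bv sN N0.
apply: supported_sub; first by have [] := sN.
by move=> k Sk; apply: trS Nj.
Qed.

Lemma submodule_supported S :
  (forall r k, S k -> supported S (witt_op mu r (bv k))) ->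
  submodule (phi mu) (supported S).
Proof.
move=> opS; apply/submoduleP; split; first exact: supported_subspace.
move=> r; apply: supported_sub => [|k /opS//].
exact: preim_subspace (witt_op_linear _ _) (supported_subspace S).
Qed.

Lemma Uspan_submodule a : submodule (phi mu) (Uspan a).
Proof.
rewrite UspanE; apply: submodule_supported => r _ [m ->].
have [e|k0] := eqVneq (a + m%:~R) 0.
  rewrite e witt_op0; apply: supportedZ.
  apply: supported_bv; exists (m - r).
  by rewrite rmorphB /= addrA e sub0r.
rewrite witt_opE //; apply: supportedZ.
by apply: supported_bv; exists (m - r); rewrite rmorphB /= addrA.
Qed.

(** All the weights of [U(a)] are nonzero, so [bv_step] joins any two of
    them. *)
Lemma Uspan_irreducible a : ~ (exists m : int, a = m%:~R) ->
  irreducible (phi mu) (Uspan a).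
Proof.
move=> aZ; rewrite UspanE; apply: irreducible_supported => N j k sN Sj Sk Nj.
have S0 l : (exists m : int, l = a + m%:~R) -> l != 0.
  move=> [m ->]; apply/eqP => /eqP; rewrite addr_eq0 => /eqP e.
  by apply: aZ; exists (- m); rewrite rmorphN.
case: Sj (S0 _ Sj) Nj => m -> j0 Nj; case: Sk (S0 _ Sk) => n -> k0.
by apply: (bv_step (r := m - n) sN Nj) => //; rewrite rmorphB /=; ring.
Qed.

(** The scalar [m - r] vanishes precisely when [p_r] would send [v_m] to
    [v_0]. *)
Lemma Ubar_submodule : submodule (phi mu) (@Ubar F).
Proof.
rewrite UbarE; apply: submodule_supported => r _ [m m0 ->].
rewrite witt_opE ?char0_intr_eq0 // -rmorphB /=.
have [->|mr] := eqVneq (m - r) 0.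
  by rewrite scale0r; apply: (supported_subspace _).1.
apply: supportedZ.
by apply: supported_bv; exists (m - r).
Qed.

Lemma Ubar_trans N (j k : F) : submodule (phi mu) N ->
  (exists2 m : int, m != 0 & j = m%:~R) ->
  (exists2 m : int, m != 0 & k = m%:~R) ->
  N (bv j) -> N (bv k).
Proof.
move=> sN [m m0 ->] [n n0 ->] Nj.
apply: (bv_step (r := m - n) sN Nj); rewrite ?char0_intr_eq0 //.
by rewrite rmorphB /=; ring.
Qed.

Lemma Ubar_irreducible : irreducible (phi mu) (@Ubar F).
Proof.
by rewrite UbarE; apply: irreducible_supported => N j k; apply: Ubar_trans.
Qed.

(** A nonzero submodule contains some [v_m]; if [m = 0], it also contains a
    [v_{-r}] with [r] nonzero. *)
Lemma Ubar_sub N : submodule (phi mu) N -> N `<=` Uspan 0 -> N <> [set 0] ->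
  @Ubar F `<=` N.
Proof.
rewrite UspanE UbarE => sN NU N0.
have [_ /[swap] /(_ _ NU) [m ->]] := nonzero_submodule_bv sN N0.
rewrite add0r => Nm.
have [l l0 Nl] : exists2 l : int, l != 0 & N (bv l%:~R).
  have [m0|m0] := eqVneq m 0; last by exists m.
  (* [p_r v_0] is nonzero unless [r] is [0] or [mu]. *)
  pose r : int := if mu == 1 then 2 else 1.
  have r0 : r != 0 by rewrite /r; case: ifP.
  have rmu : mu - r%:~R != 0.
    rewrite /r; case: (eqVneq mu 1) => [->|mu1]; last by rewrite subr_eq0.
    by rewrite -[1]/(1%:~R) -rmorphB /= char0_intr_eq0.
  exists (- r); first by rewrite oppr_eq0.
  have [sN' opN] := (submoduleP _).1 sN.
  move: Nm; rewrite m0 => /(opN r); rewrite witt_op0 => Nr.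
  have c0 : r%:~R * (mu - r%:~R) != 0 by rewrite mulf_neq0 // char0_intr_eq0.
  have := subspaceZ (r%:~R * (mu - r%:~R))^-1 sN' Nr.
  by rewrite scalerA mulVf // scale1r rmorphN.
apply: supported_sub => [|k Sk]; first by have [] := sN.
by apply: Ubar_trans Nl => //; exists l.
Qed.

Lemma Ubar_Uspan0 : @Ubar F `<=` Uspan 0.
Proof.
rewrite UspanE UbarE; apply: supported_sub => [|k [m _ ->]].
  exact: supported_subspace.
by apply: supported_bv; exists m; rewrite add0r.
Qed.

(** Two nonzero summands would both contain [v_1]. *)
Lemma Uspan0_indecomposable : indecomposable (phi mu) (Uspan 0).
Proof.
move=> N1 N2 sN1 sN2 N12 NU.
have [|N10] := pselect (N1 = [set 0]); first by left.
have [|N20] := pselect (N2 = [set 0]); first by right.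
have N1U : N1 `<=` Uspan 0.
  move=> v Nv; rewrite -NU; exists v => //.
  by exists 0; rewrite ?addr0 //; apply sN2.1.1.
have N2U : N2 `<=` Uspan 0.
  move=> v Nv; rewrite -NU; exists 0; first by apply sN1.1.1.
  by exists v; rewrite ?add0r.
have b1 : @Ubar F (bv 1).
  by rewrite UbarE; apply: supported_bv; exists 1.
have : [set 0] (bv 1 : Vmod F).
  by rewrite -N12; split; [apply: (Ubar_sub sN1)|apply: (Ubar_sub sN2)].
move=> /= /(congr1 (vcoef 1)) /eqP.
by rewrite vcoef_bv eqxx /vcoef mcoeff0 oner_eq0.
Qed.

Lemma phi_reducible : reducible (phi mu) setT.
Proof.
have nv0 : ~ @Ubar F (bv 0).
  rewrite UbarE => /(_ 0); rewrite vcoef_bv eqxx oner_eq0 => /(_ isT) [m m0].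
  by move/esym/eqP; rewrite char0_intr_eq0 // (negPf m0).
have v1 : @Ubar F (bv 1).
  by rewrite UbarE; apply: supported_bv; exists 1.
move=> /(_ _ Ubar_submodule (@subsetT _ _)) [U0|UT]; last first.
  by apply: nv0; rewrite UT.
move: v1; rewrite U0 => /= /(congr1 (vcoef 1)) /eqP.
by rewrite vcoef_bv eqxx /vcoef mcoeff0 oner_eq0.
Qed.

(** At [L_1, L_2, M_0, M_1] the second axiom of 3-Lie modules becomes
    [p_2 = p_2 p_0 - p_1 p_1].  This quadratic relation does hold at every
    [v_a] with [a] nonzero, so only the exceptional formula at [v_0]
    obstructs. *)
Lemma phi_not_induced : ~ induced_module (phi mu).
Proof.
move=> [rho [[_ _ _ _ _ rho_br] _ [_ rhoE]]].
have rhoLL r s : rho (bL F r) (bL F s) = 0.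
  by rewrite -rhoE (adm_LL charF0) (linZ (phi_linear charF0 mu))
    (phi_ad_basis charF0 mu (inr (inl _))) scaler0.
have rhoLM r s : rho (bL F r) (bM F s) = witt_op mu (r - s).
  rewrite -rhoE (adm_LM charF0) (linB (phi_linear charF0 mu)).
  rewrite (linZ (phi_linear charF0 mu)) (phi_ad_basis charF0 mu (inl (inl _))).
  by rewrite (phi_ad_basis charF0 mu (inl (inr _))) scaler0 subr0.
have rhoML r s : rho (bM F r) (bL F s) = - witt_op mu (s - r).
  by rewrite -rhoLM -!rhoE adm_skew (linZ (phi_linear charF0 mu)) scaleN1r.
have := rho_br (bL F 1) (bL F 2) (bM F 0) (bM F 1).
have -> : [3 bL F 1, bL F 2, bM F 0] = bL F 3.
  by rewrite [LHS]Aod_brU /= scale1r.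
rewrite rhoLL !rhoLM rhoML => /(congr1 (fun f => f (bv 0))) /=.
rewrite !fctE /= -[(3 - 1)%R]/(2 : int) -[(2 - 0)%R]/(2 : int)
  -[(1 - 1)%R]/(0 : int).
rewrite -[(1 - 0)%R]/(1 : int) -[(2 - 1)%R]/(1 : int).
rewrite !witt_op0 !(linZ (witt_op_linear _ _)) mul0r scale0r.
rewrite !add0r (@witt_opE _ _ _ (- 1)); last by rewrite oppr_eq0 oner_eq0.
rewrite scalerA -scaleNr -opprD => /(congr1 (vcoef (- 2))).
rewrite !(linZ (vcoef_linear _)) vcoef_bv eqxx /GRing.scale /= !mulr1 => /eqP.
rewrite -subr_eq0.
have -> : 2 * (mu - 2) - - (1 * (mu - 1) * - (1 + 1)) = - 2 :> F by ring.
by rewrite oppr_eq0 (negPf (two_neq0 charF0)).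
Qed.
End Submodules.

Theorem theorem3p8 (F : fieldType) (charF0 : [pchar F] =i pred0) (mu : F) :
  [/\ lie_module (phi mu) /\ reducible (phi mu) setT,
      forall a : F, ~ (exists m : int, a = m%:~R) ->
        submodule (phi mu) (Uspan a) /\ irreducible (phi mu) (Uspan a),
      [/\ submodule (phi mu) (Uspan 0),
          indecomposable (phi mu) (Uspan 0),
          @Ubar F `<=` Uspan 0,
          submodule (phi mu) (@Ubar F) &
          irreducible (phi mu) (@Ubar F)] &
      ~ induced_module (phi mu)].
Proof.
split.
- by split; [apply: phi_lie_module|apply: phi_reducible].
- by move=> a aZ; split; [apply: Uspan_submodule|apply: Uspan_irreducible].
- split; [exact: Uspan_submodule|exact: Uspan0_indecomposable|
    exact: Ubar_Uspan0|exact: Ubar_submodule|exact: Ubar_irreducible].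
- exact: phi_not_induced.
Qed.
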